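(* Let $\mathbb{K}$ be a field, $J=J_0\sqcup\overline{J_0}$, $R_j\in\mathbb{K}\langle X_i, i\in I\rangle$ for $j\in J$, let $\mathbb{A}=\mathbb{K}\langle X_i, i\in I\mid R_j=0, j\in J\rangle$ and let $\mathbb{A}^{c,J_0}$ be its partial centrification (defined in the context). Suppose that $\mathbb{H}=\mathbb{K}\langle X_i, i\in I\mid R_j=0, j\in\overline{J_0}\rangle$ is a Hopf algebra with comultiplication $\Delta$, counit $\epsilon$ and antipode $S$; let $\pi:\mathbb{H}\to\mathbb{A}^{c,J_0}$ be the natural map, $\widetilde{R}_j$ the image of $R_j$ in $\mathbb{H}$, $\mathbb{S}$ the subalgebra of $\mathbb{H}$ generated by the $\widetilde{R}_j$, $j\in J_0$, and $\mathbb{S}^+=\mathbb{S}\cap\ker(\epsilon)$. Write $C=\pi^{-1}(\operatorname{Cent}(\mathbb{A}^{c,J_0}))$, where $\operatorname{Cent}$ denotes the centre. Suppose that $$\Delta(R)\in\mathbb{S}^+\otimes C+C\otimes\mathbb{S}^+$$ for all $R\in\{\widetilde{R}_j\}_{j\in J_0}$, that $S(R)\in\mathbb{S}$ for all $R\in\{\widetilde{R}_j\}_{j\in J_0}$, and that all the $\widetilde{R}_j$, $j\in J_0$, lie in $\ker(\epsilon)$. Then $\mathbb{A}$ is a Hopf algebra over $\mathbb{K}$ and the natural map $\mathbb{A}^{c,J_0}\to\mathbb{A}$ is a homomorphism of Hopf algebras. If, in fact, $\Delta(R)\in\mathbb{S}^+\otimes\mathbb{S}+C\otimes\mathbb{S}^+$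 for all $R\in\{\widetilde{R}_j\}_{j\in J_0}$, then $\mathcal{Z}$, the subalgebra of $\mathbb{A}^{c,J_0}$ generated by the images $\overline{R}_j$ of $R_j$, $j\in J_0$, is a subalgebra of the coinvariants $(\mathbb{A}^{c,J_0})^{co\,\mathbb{A}}$.
   Context: The partial centrification is $$\mathbb{A}^{c,J_0}=\mathbb{K}\langle X_i, i\in I\mid X_iR_j=R_jX_i,\ (i,j)\in I\times J_0;\ R_j=0,\ j\in\overline{J_0}\rangle ;$$ there are natural surjective algebra maps $\mathbb{H}\xrightarrow{\pi}\mathbb{A}^{c,J_0}\to\mathbb{A}$ sending generators to generators. Tensor products are over $\mathbb{K}$. Convention: saying that a quotient algebra of the Hopf algebra $\mathbb{H}$ ''is a Hopf algebra'' means that the Hopf algebra structure of $\mathbb{H}$ descends to it, i.e. the kernel of the quotient map is a Hopf ideal; $\mathbb{A}^{c,J_0}$ carries such an induced Hopf structure under the stated hypotheses (part of what is asserted). $\mathbb{A}^{c,J_0}$ is regarded as a right $\mathbb{A}$-comodule algebra via $\rho:\mathbb{A}^{c,J_0}\xrightarrow{\Delta}\mathbb{A}^{c,J_0}\otimes\mathbb{A}^{c,J_0}\to\mathbb{A}^{c,J_0}\otimes\mathbb{A}$, and $(\mathbb{A}^{c,J_0})^{co\,\mathbb{A}}=\{Y\mid\rho(Y)=Y\otimes 1\}$. *)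

(* Defs.v *)
From HB Require Import structures.
From mathcomp Require Import all_boot all_algebra.
From mathcomp Require Import finmap boolp classical_sets.
From mathcomp Require Import ring_quotient.
From mathcomp Require Import monalg.

Set Implicit Arguments.
Unset Strict Implicit.
Unset Printing Implicit Defensive.

Import GRing.Theory.

Local Open Scope classical_set_scope.
Local Open Scope ring_scope.

(* MathComp's [algType] only has nonzero rings, but an algebra given by
   generators and relations may be zero. *)
HB.mixin Record Lmodule_isPzAlgebra (K : fieldType) A of GRing.Lmodule K A := {
  pzone : A;
  pzmul : A -> A -> A;
  pzmulA : associative pzmul;
  pzmul1l : left_id pzone pzmul;
  pzmul1r : right_id pzone pzmul;
  pzmulDl : left_distributive pzmul +%R;
  pzmulDr : right_distributive pzmul +%R;
  pzmulZl : forall (a : K) (x y : A), pzmul (a *: x) y = a *: pzmul x y;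
  pzmulZr : forall (a : K) (x y : A), pzmul x (a *: y) = a *: pzmul x y
}.

#[short(type="pzAlgType")]
HB.structure Definition PzAlgebra (K : fieldType) :=
  {A of Lmodule_isPzAlgebra K A & GRing.Lmodule K A}.

HB.instance Definition _ (K : fieldType) (A : pzAlgType K) :=
  GRing.Zmodule_isPzRing.Build (PzAlgebra.sort A)
    (@pzmulA K A) (@pzmul1l K A) (@pzmul1r K A) (@pzmulDl K A) (@pzmulDr K A).

Lemma pzscalerAl (K : fieldType) (A : pzAlgType K) (a : K) (x y : A) :
  (a *: x) * y = a *: (x * y).
Proof. exact: pzmulZl. Qed.

Lemma pzscalerAr (K : fieldType) (A : pzAlgType K) (a : K) (x y : A) :
  x * (a *: y) = a *: (x * y).
Proof. exact: pzmulZr. Qed.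

Definition is_alg_hom (K : fieldType) (A B : pzAlgType K) (f : A -> B) :=
  linear f /\ monoid_morphism f.

Section Closures.
Variable K : fieldType.

Definition is_submod (V : lmodType K) (S : set V) :=
  S 0 /\ forall (a : K) u v, S u -> S v -> S (a *: u + v).

Definition lspan (V : lmodType K) (E : set V) : set V := smallest (@is_submod V) E.

Variable A : pzAlgType K.

Definition is_ideal (S : set A) :=
  is_submod S /\ forall x y, S x -> S (y * x) /\ S (x * y).

Definition is_subalg (S : set A) :=
  [/\ is_submod S, S 1 & forall x y, S x -> S y -> S (x * y)].

Definition ideal_gen (E : set A) : set A := smallest (@is_ideal) E.

Definition subalg_gen (E : set A) : set A := smallest is_subalg E.

Definition centre : set A := [set x | forall y, x * y = y * x].

End Closures.

Arguments centre {K} A.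

Section LinearQuotient.
Variables (K : fieldType) (V : lmodType K).

Lemma lspan_submod (E : set V) : is_submod (lspan E).
Proof.
split; first by move=> S [[S0 _] _].
by move=> a u v Eu Ev S [Ssub ES]; apply: Ssub.2; [exact: Eu|exact: Ev].
Qed.

Lemma sub_lspan (E : set V) : E `<=` lspan E.
Proof. by move=> x Ex S [_]; apply. Qed.

Lemma lspanZ (E : set V) (a : K) u : lspan E u -> lspan E (a *: u).
Proof.
by have [S0 Sl] := lspan_submod E => Eu; rewrite -[_ *: _]addr0; exact: Sl.
Qed.

Definition span_pred (E : set V) : {pred V} := fun x => `[< lspan E x >].

Lemma span_pred_zmod (E : set V) : zmod_closed (span_pred E).
Proof.
have [S0 Sl] := lspan_submod E.
split=> [|x y /asboolP Ex /asboolP Ey]; apply/asboolP => //.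
by rewrite addrC -scaleN1r; apply: Sl.
Qed.

HB.instance Definition _ (E : set V) :=
  GRing.isZmodClosed.Build V (span_pred E) (span_pred_zmod E).

(* the quotient of V by the subspace spanned by E *)
Definition lquot (E : set V) : Type := Quotient.quot (span_pred E).

HB.instance Definition _ (E : set V) := GRing.Zmodule.on (lquot E).

End LinearQuotient.

HB.lock Definition lproj (K : fieldType) (V : lmodType K) (E : set V) (x : V) :
  lquot E := (\pi_(Quotient.quot (span_pred E)) x)%qT.

HB.lock Definition lrepr (K : fieldType) (V : lmodType K) (E : set V)
    (x : lquot E) : V :=
  generic_quotient.repr (x : Quotient.quot (span_pred E)).

HB.lock Definition lquot_scale (K : fieldType) (V : lmodType K) (E : set V)
    (a : K) (x : lquot E) : lquot E := lproj E (a *: lrepr x).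

Section LinearQuotientTheory.
Variables (K : fieldType) (V : lmodType K) (E : set V).

Lemma lreprK : cancel (@lrepr K V E) (lproj E).
Proof. by move=> x; rewrite lproj.unlock lrepr.unlock generic_quotient.reprK. Qed.

Lemma lprojP x y : lproj E x = lproj E y <-> lspan E (x - y).
Proof.
rewrite lproj.unlock; split=> [/eqP|Exy]; first by rewrite -Quotient.idealrBE => /asboolP.
by apply/eqP; rewrite -Quotient.idealrBE; apply/asboolP.
Qed.

Lemma lprojD : {morph lproj E : x y / x + y}.
Proof. by rewrite lproj.unlock; exact: (@raddfD _ _ (\pi_(Quotient.quot (span_pred E))%qT)). Qed.

Lemma lprojZ_subproof a x : lquot_scale a (lproj E x) = lproj E (a *: x).
Proof. by rewrite lquot_scale.unlock; apply/lprojP; rewrite -scalerBr; apply: lspanZ; apply/lprojP; exact: lreprK. Qed.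

Lemma lquot_scaleA a b v :
  lquot_scale a (lquot_scale b v) = lquot_scale (a * b) (v : lquot E).
Proof. by rewrite -[v]lreprK !lprojZ_subproof scalerA. Qed.

Lemma lquot_scale1 : left_id 1 (@lquot_scale K V E).
Proof. by move=> v; rewrite lquot_scale.unlock scale1r lreprK. Qed.

Lemma lquot_scaleDr : right_distributive (@lquot_scale K V E) +%R.
Proof.
move=> a u v; rewrite -[u]lreprK -[v]lreprK -lprojD !lprojZ_subproof.
by rewrite scalerDr lprojD.
Qed.

Lemma lquot_scaleDl v : {morph (@lquot_scale K V E)^~ v : a b / a + b}.
Proof. by move=> a b; rewrite lquot_scale.unlock scalerDl lprojD. Qed.

HB.instance Definition _ := GRing.Zmodule_isLmodule.Build K (lquot E)
  lquot_scaleA lquot_scale1 lquot_scaleDr lquot_scaleDl.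

Lemma lproj_linear : linear (lproj E).
Proof. by move=> a x y; rewrite lprojD -lprojZ_subproof. Qed.

HB.instance Definition _ :=
  GRing.isLinear.Build K V (lquot E) *:%R (lproj E) lproj_linear.

End LinearQuotientTheory.

Section AlgebraQuotient.
Variables (K : fieldType) (A : pzAlgType K).

Lemma ideal_gen_ideal (E : set A) : is_ideal (ideal_gen E).
Proof.
split; first split; first by move=> S [[[S0 _] _] _].
  move=> a u v Eu Ev S [Sid ES]; apply: Sid.1.2; first exact: Eu.
  exact: Ev.
move=> x y Ex; split=> S [Sid ES].
  by have [] := Sid.2 x y (Ex S (conj Sid ES)).
by have [] := Sid.2 x y (Ex S (conj Sid ES)).
Qed.

Lemma lspan_ideal (E : set A) : lspan (ideal_gen E) = ideal_gen E.
Proof.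
apply/seteqP; split; last exact: sub_lspan.
by move=> x; apply; split=> //; exact: (ideal_gen_ideal E).1.
Qed.

(* the quotient of A by the two-sided ideal generated by E *)
Definition quot_alg (E : set A) : Type := lquot (ideal_gen E).

HB.instance Definition _ (E : set A) := GRing.Lmodule.on (quot_alg E).

Definition qproj (E : set A) : A -> quot_alg E := @lproj K A (ideal_gen E).

Definition qrepr (E : set A) : quot_alg E -> A := @lrepr K A (ideal_gen E).

End AlgebraQuotient.

HB.lock Definition qmul (K : fieldType) (A : pzAlgType K) (E : set A)
    (x y : quot_alg E) : quot_alg E := qproj E (qrepr x * qrepr y).

Section AlgebraQuotientTheory.
Variables (K : fieldType) (A : pzAlgType K) (E : set A).
Local Notation qmul := (@qmul K A E).

Lemma qreprK : cancel (@qrepr K A E) (qproj E).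
Proof. exact: lreprK. Qed.

Lemma qprojP x y : qproj E x = qproj E y <-> ideal_gen E (x - y).
Proof. by rewrite -lspan_ideal; exact: lprojP. Qed.

Lemma qproj_linear : linear (qproj E).
Proof. exact: lproj_linear. Qed.

HB.instance Definition _ :=
  GRing.isLinear.Build K A (quot_alg E) *:%R (qproj E) qproj_linear.

Definition qone : quot_alg E := qproj E 1.

Lemma qprojM_subproof x y : qmul (qproj E x) (qproj E y) = qproj E (x * y).
Proof.
have [[_ Il] Iid] := ideal_gen_ideal E.
have Ix : ideal_gen E (qrepr (qproj E x) - x) by apply/qprojP; exact: qreprK.
have Iy : ideal_gen E (qrepr (qproj E y) - y) by apply/qprojP; exact: qreprK.
rewrite qmul.unlock; apply/qprojP; set x' := qrepr _; set y' := qrepr _.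
have -> : x' * y' - x * y = 1 *: ((x' - x) * y') + x * (y' - y).
  by rewrite scale1r mulrBl mulrBr addrA addrNK.
by apply: Il; [exact: (Iid _ _ Ix).2|exact: (Iid _ _ Iy).1].
Qed.

Lemma qmulA : associative qmul.
Proof.
move=> x y z; rewrite -[x]qreprK -[y]qreprK -[z]qreprK !qprojM_subproof.
by rewrite mulrA.
Qed.

Lemma qmul1l : left_id qone qmul.
Proof. by move=> x; rewrite -[x]qreprK qprojM_subproof mul1r. Qed.

Lemma qmul1r : right_id qone qmul.
Proof. by move=> x; rewrite -[x]qreprK qprojM_subproof mulr1. Qed.

Lemma qmulDl : left_distributive qmul +%R.
Proof.
move=> x y z; rewrite -[x]qreprK -[y]qreprK -[z]qreprK -raddfD.
by rewrite !qprojM_subproof mulrDl raddfD.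
Qed.

Lemma qmulDr : right_distributive qmul +%R.
Proof.
move=> x y z; rewrite -[x]qreprK -[y]qreprK -[z]qreprK -raddfD.
by rewrite !qprojM_subproof mulrDr raddfD.
Qed.

Lemma qmulZl (a : K) x y : qmul (a *: x) y = a *: qmul x y.
Proof.
rewrite -[x]qreprK -[y]qreprK -linearZ !qprojM_subproof.
by rewrite pzscalerAl linearZ.
Qed.

Lemma qmulZr (a : K) x y : qmul x (a *: y) = a *: qmul x y.
Proof.
rewrite -[x]qreprK -[y]qreprK -linearZ !qprojM_subproof.
by rewrite pzscalerAr linearZ.
Qed.

HB.instance Definition _ := Lmodule_isPzAlgebra.Build K (quot_alg E)
  qmulA qmul1l qmul1r qmulDl qmulDr qmulZl qmulZr.
HB.instance Definition _ :=
  GRing.PzRing.copy (quot_alg E) (PzAlgebra.sort (quot_alg E : pzAlgType K)).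

Lemma qproj_alg_hom : @is_alg_hom K A (quot_alg E) (qproj E).
Proof.
split; first exact: qproj_linear.
by split=> // x y; rewrite -qprojM_subproof.
Qed.

End AlgebraQuotientTheory.

Section Tensor.
Variable K : fieldType.

(* The tensor product over K is the free vector space on V * W modulo
   bilinearity. *)
Definition tensor_rels (V W : lmodType K) : set {malg K[(V * W)%type]} :=
  [set r | (exists a u u' v,
              r = << (a *: u + u', v) >> - (a *: << (u, v) >> + << (u', v) >>))
        \/ (exists a u v v',
              r = << (u, a *: v + v') >> - (a *: << (u, v) >> + << (u, v') >>))].

Definition tensor (V W : lmodType K) : Type := lquot (@tensor_rels V W).

HB.instance Definition _ (V W : lmodType K) := GRing.Lmodule.on (tensor V W).

End Tensor.

HB.lock Definition tpure (K : fieldType) (V W : lmodType K) (v : V) (w : W) :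
  tensor V W := lproj (@tensor_rels K V W) << (v, w) >>.

Notation "v *t w" := (tpure v w) (at level 40, left associativity).

HB.lock Definition flift (K : fieldType) (V W U : lmodType K)
    (f : V -> W -> U) (r : {malg K[(V * W)%type]}) : U :=
  \sum_(k <- msupp r) r@_k *: f k.1 k.2.

(* the linear map sending v *t w to f v w, for f bilinear (junk otherwise) *)
HB.lock Definition tlift (K : fieldType) (V W U : lmodType K)
  (f : V -> W -> U) (t : tensor V W) : U := flift f (lrepr t).

Section TensorTheory.
Variable K : fieldType.

Definition bilin (V W U : lmodType K) (f : V -> W -> U) :=
  (forall v, linear (f v)) /\ (forall w, linear (f^~ w)).

Section Lift.
Variables (V W U : lmodType K).

Lemma tpure_bilin : bilin (@tpure K V W).
Proof.
split=> [v a w w'|w a v v']; rewrite tpure.unlock -linearP; apply/lprojP; apply: sub_lspan.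
  by right; exists a, v, w, w'.
by left; exists a, v, v', w.
Qed.

Lemma fliftw (f : V -> W -> U) (d : {fset (V * W)%type}) r : (msupp r `<=` d)%fset ->
  flift f r = \sum_(k <- d) r@_k *: f k.1 k.2.
Proof.
move=> le; rewrite flift.unlock; apply: big_fset_incl => // k kd /mcoeff_outdom ->.
by rewrite scale0r.
Qed.

Lemma flift_linear (f : V -> W -> U) : linear (flift f).
Proof.
move=> a x y; set d := (msupp x `|` msupp y)%fset.
have dx : (msupp x `<=` d)%fset by exact: fsubsetUl.
have dy : (msupp y `<=` d)%fset by exact: fsubsetUr.
have dxy : (msupp (a *: x + y) `<=` d)%fset.
  apply: fsubset_trans (msuppD_le _ _) _; rewrite fsubUset dy andbT.
  exact: fsubset_trans (msuppZ_le _ _) dx.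
rewrite (fliftw f dxy) (fliftw f dx) (fliftw f dy) scaler_sumr -big_split /=.
by apply: eq_bigr => k _; rewrite mcoeffD mcoeffZ scalerDl scalerA.
Qed.

Lemma fliftU (f : V -> W -> U) k : flift f << k >> = f k.1 k.2.
Proof. by rewrite (fliftw f msuppU_le) big_seq_fset1 mcoeffUU scale1r. Qed.

Variable f : V -> W -> U.
Hypothesis f_bilin : bilin f.

Lemma flift_rel r : lspan (@tensor_rels K V W) r -> flift f r = 0.
Proof.
have fl : linear (flift f) by exact: flift_linear.
have f0 : flift f 0 = 0.
  by rewrite (fliftw f (d := fset0)) ?big_seq_fset0 // msupp0.
move=> /(_ [set r | flift f r = 0]); apply; split.
  by split=> // a u v hu hv /=; rewrite fl hu hv scaler0 addr0.
have [fr fw] := f_bilin.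
move=> _ [[a [u [u' [v ->]]]]|[a [u [v [v' ->]]]]] /=.
  by rewrite addrC -scaleN1r !fl !fliftU /= fw scaleN1r addNr.
by rewrite addrC -scaleN1r !fl !fliftU /= fr scaleN1r addNr.
Qed.

Lemma tlift_proj r : tlift f (lproj (@tensor_rels K V W) r) = flift f r.
Proof.
rewrite tlift.unlock; set r' := lrepr _.
have : lspan (@tensor_rels K V W) (r' - r) by apply/lprojP; exact: lreprK.
move/flift_rel; rewrite addrC -scaleN1r flift_linear scaleN1r.
by move/eqP; rewrite addrC subr_eq0 => /eqP.
Qed.

Lemma tlift_pure v w : tlift f (v *t w) = f v w.
Proof. by rewrite tpure.unlock tlift_proj fliftU. Qed.

Lemma tlift_linear : linear (tlift f).
Proof.
move=> a x y; rewrite -[x]lreprK -[y]lreprK -linearP !tlift_proj.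
exact: flift_linear.
Qed.

End Lift.

Lemma tlift_param (V W X U : lmodType K) (f : X -> V -> W -> U) :
    (forall v w, linear (fun x => f x v w)) ->
  forall t, linear (fun x => tlift (f x) t).
Proof.
move=> fl t a x y; rewrite tlift.unlock flift.unlock scaler_sumr -big_split /=.
by apply: eq_bigr => k _; rewrite fl scalerDr !scalerA mulrC.
Qed.

Lemma tensor_ind (V W : lmodType K) (P : tensor V W -> Prop) :
    P 0 -> (forall (a : K) s t, P s -> P t -> P (a *: s + t)) ->
    (forall v w, P (v *t w)) ->
  forall t, P t.
Proof.
move=> P0 Pl Pp t; rewrite -[t]lreprK [lrepr t]monalgE raddf_sum /=.
elim: (msupp _ : seq _) => [|k s IH]; first by rewrite big_nil.
rewrite big_cons; set c := _@_k.
have -> : << c *g k >> = c *: << k >> :> {malg K[(V * W)%type]}.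
  apply/malgP=> l; rewrite mcoeffZ !mcoeffU.
  by case: eqP => _ /=; rewrite ?mulr1n ?mulr0n ?mulr1 ?mulr0.
rewrite linearZ /=; apply: Pl => //; case: k {c} => v w.
by have := Pp v w; rewrite tpure.unlock.
Qed.

Definition tmap (V W V' W' : lmodType K) (f : V -> V') (g : W -> W') :
    tensor V W -> tensor V' W' :=
  tlift (fun v w => f v *t g w).

Definition tassoc (U V W : lmodType K) :
    tensor (tensor U V) W -> tensor U (tensor V W) :=
  tlift (fun t w => tlift (fun u v => u *t (v *t w)) t).

(* the image in the tensor product of the tensor product of the subspaces
   P and Q *)
Definition tsub (V W : lmodType K) (P : set V) (Q : set W) :
    set (tensor V W) :=
  lspan [set v *t w | v in P & w in Q].

Definition sumsub (V : lmodType K) (P Q : set V) : set V :=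
  [set x + y | x in P & y in Q].

End TensorTheory.

(* (a *t b) * (c *t d) = (a * c) *t (b * d) *)
HB.lock Definition tmul (K : fieldType) (A B : pzAlgType K)
    (s t : tensor A B) : tensor A B :=
  tlift (fun (a : A) (b : B) =>
    tlift (fun (c : A) (d : B) => (a * c) *t (b * d)) t) s.

Section TensorAlgebra.
Variables (K : fieldType) (A B : pzAlgType K).
Local Notation tmul := (@tmul K A B).

Definition tone : tensor A B := (1 : A) *t (1 : B).

Lemma tmul_bilin_in (a : A) (b : B) :
  bilin (fun (c : A) (d : B) => (a * c) *t (b * d)).
Proof.
split=> [c k d d'|d k c c'] /=; rewrite mulrDr pzscalerAr.
  exact: (tpure_bilin A B).1.
exact: (tpure_bilin A B).2.
Qed.

Lemma tmul_bilin_out (t : tensor A B) :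
  bilin (fun (a : A) (b : B) => tlift (fun (c : A) (d : B) => (a * c) *t (b * d)) t).
Proof.
split=> [a|b]; apply: tlift_param => c d k x y; rewrite mulrDl pzscalerAl.
  exact: (tpure_bilin A B).1.
exact: (tpure_bilin A B).2.
Qed.

Lemma tmul_pure a b c d : tmul (a *t b) (c *t d) = (a * c) *t (b * d).
Proof.
rewrite tmul.unlock tlift_pure; last exact: tmul_bilin_out.
by rewrite tlift_pure //; exact: tmul_bilin_in.
Qed.

Lemma tmul_linearl t : linear (tmul^~ t).
Proof. by rewrite tmul.unlock; apply: tlift_linear; exact: tmul_bilin_out. Qed.

Lemma tmul_linearr s : linear (tmul s).
Proof.
rewrite tmul.unlock; apply: (tlift_param (f := fun t (a : A) (b : B) =>
  tlift (fun (c : A) (d : B) => (a * c) *t (b * d)) t)) => a b.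
by apply: tlift_linear; exact: tmul_bilin_in.
Qed.

Lemma tmulDl : left_distributive tmul +%R.
Proof. by move=> x y z; have := tmul_linearl z 1 x y; rewrite !scale1r. Qed.

Lemma tmulDr : right_distributive tmul +%R.
Proof. by move=> x y z; have := tmul_linearr x 1 y z; rewrite !scale1r. Qed.

Lemma tmul0l t : tmul 0 t = 0.
Proof. by apply: (addIr (tmul 0 t)); rewrite -tmulDl !add0r. Qed.

Lemma tmul0r t : tmul t 0 = 0.
Proof. by apply: (addIr (tmul t 0)); rewrite -tmulDr !add0r. Qed.

Lemma tmulZl (k : K) s t : tmul (k *: s) t = k *: tmul s t.
Proof. by have := tmul_linearl t k s 0; rewrite tmul0l !addr0. Qed.

Lemma tmulZr (k : K) s t : tmul s (k *: t) = k *: tmul s t.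
Proof. by have := tmul_linearr s k t 0; rewrite tmul0r !addr0. Qed.

Lemma tmulA : associative tmul.
Proof.
move=> s t u; elim/tensor_ind: s => [|h s s' hs hs'|a b].
- by rewrite !tmul0l.
- by rewrite !(tmulDl, tmulZl) hs hs'.
elim/tensor_ind: t => [|h s s' hs hs'|c d].
- by rewrite !(tmul0l, tmul0r).
- by rewrite !(tmulDl, tmulZl, tmulDr, tmulZr) hs hs'.
elim/tensor_ind: u => [|h s s' hs hs'|e f].
- by rewrite !tmul0r.
- by rewrite !(tmulDr, tmulZr) hs hs'.
by rewrite !tmul_pure !mulrA.
Qed.

Lemma tmul1l : left_id tone tmul.
Proof.
elim/tensor_ind => [|h s s' hs hs'|a b]; first by rewrite tmul0r.
  by rewrite !(tmulDr, tmulZr) hs hs'.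
by rewrite tmul_pure !mul1r.
Qed.

Lemma tmul1r : right_id tone tmul.
Proof.
elim/tensor_ind => [|h s s' hs hs'|a b]; first by rewrite tmul0l.
  by rewrite !(tmulDl, tmulZl) hs hs'.
by rewrite tmul_pure !mulr1.
Qed.

HB.instance Definition _ := Lmodule_isPzAlgebra.Build K (tensor A B)
  tmulA tmul1l tmul1r tmulDl tmulDr tmulZl tmulZr.
HB.instance Definition _ :=
  GRing.PzRing.copy (tensor A B) (PzAlgebra.sort (tensor A B : pzAlgType K)).

End TensorAlgebra.

Definition ker (T : Type) (U : nmodType) (f : T -> U) : set T :=
  [set x | f x = 0].

Section HopfAlgebra.
Variable K : fieldType.

Record hopf_structure (A : pzAlgType K) := HopfStructure {
  comul : A -> tensor A A;
  counit : A -> K;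
  antipode : A -> A;
  comul_hom : is_alg_hom comul;
  counit_hom : scalar counit /\ monoid_morphism counit;
  antipode_linear : linear antipode;
  comulA : forall x, tassoc (tmap comul id (comul x)) = tmap id comul (comul x);
  counitl : forall x, tlift (fun (a b : A) => counit a *: b) (comul x) = x;
  counitr : forall x, tlift (fun (a b : A) => counit b *: a) (comul x) = x;
  antipodel : forall x,
    tlift (fun (a b : A) => antipode a * b) (comul x) = counit x *: (1 : A);
  antipoder : forall x,
    tlift (fun (a b : A) => a * antipode b) (comul x) = counit x *: (1 : A)
}.

Definition is_hopf_hom (A B : pzAlgType K) (hA : hopf_structure A)
    (hB : hopf_structure B) (f : A -> B) :=
  [/\ is_alg_hom f,
      forall x, comul hB (f x) = tmap f f (comul hA x),
      forall x, counit hB (f x) = counit hA x &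
      forall x, antipode hB (f x) = f (antipode hA x)].

Definition is_hopf_ideal (A : pzAlgType K) (hA : hopf_structure A)
    (I : set A) :=
  [/\ is_ideal I,
      forall x, I x -> sumsub (tsub I setT) (tsub setT I) (comul hA x),
      forall x, I x -> counit hA x = 0 &
      forall x, I x -> I (antipode hA x)].

(* the coaction (id \otimes f) \circ Delta of B on A induced by f : A -> B *)
Definition coaction (A B : pzAlgType K) (hA : hopf_structure A) (f : A -> B)
    (x : A) : tensor A B :=
  tmap id f (comul hA x).

Definition coinvariants (A B : pzAlgType K) (rho : A -> tensor A B) : set A :=
  [set y | rho y = y *t (1 : B)].

End HopfAlgebra.

Section Presentations.
Variables (K : fieldType) (I : choiceType).

Definition free_alg : Type := {malg K[{fmonom I}]}.

HB.instance Definition _ := GRing.Lmodule.copy free_alg {malg K[{fmonom I}]}.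

Lemma free_mulZr (a : K) (x y : {malg K[{fmonom I}]}) :
  x * (a *: y) = a *: (x * y).
Proof.
apply/malgP=> k.
rewrite mcoeffZ (mcoeffMlw k (fsubset_refl _) (msuppZ_le a y)) mcoeffMl.
rewrite mulr_sumr; apply: eq_bigr => k1 _; rewrite mulr_sumr.
by apply: eq_bigr => k2 _; rewrite mcoeffZ mulrCA mulrnAr.
Qed.

HB.instance Definition _ := Lmodule_isPzAlgebra.Build K free_alg
  (@mulrA {malg K[{fmonom I}]}) (@mul1r _) (@mulr1 _) (@mulrDl _) (@mulrDr _)
  (fun a x y => esym (scalerAl a (x : {malg K[{fmonom I}]}) y)) free_mulZr.
HB.instance Definition _ :=
  GRing.PzRing.copy free_alg (PzAlgebra.sort (free_alg : pzAlgType K)).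

Definition gen (i : I) : free_alg := << fmu i >>.

(* K< X_i, i in I | r = 0, r in E > *)
Definition presented (E : set free_alg) : pzAlgType K := quot_alg E.

(* The map K<X | E> -> K<X | F> sending generators to generators; it does not
   depend on the representative chosen by qrepr when the relations E hold in
   K<X | F>, see natural_map_proj. *)
Definition natural_map (E F : set free_alg) (x : presented E) : presented F :=
  qproj F (qrepr x).

Lemma natural_map_proj (E F : set free_alg) (x : free_alg) :
  E `<=` ideal_gen F -> natural_map F (qproj E x) = qproj F x.
Proof.
move=> EF; apply/qprojP.
have : ideal_gen E (qrepr (qproj E x) - x) by apply/qprojP; exact: qreprK.
by apply; split => //; exact: ideal_gen_ideal.
Qed.

Definition centrification_rels (J : Type) (J0 : set J) (R : J -> free_alg) :
    set free_alg :=
  [set gen i * R j - R j * gen i | i in setT & j in J0] `|` R @` (~` J0).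

End Presentations.

(* Main.v *)
(* Write I for the kernel of H -> A^c. Since S and C map to the centre of A^c,
   for x in H the commutator [Delta x, Delta R_j] is a sum of terms
     [a (x) b, c (x) d] = [a, c] (x) b d + c a (x) [b, d],   c, d in C,
   which lie in I (x) H + H (x) I; and the antipode, being anti-multiplicative,
   sends [x, R_j] to [S R_j, S x] with S R_j in S. Hence I is a Hopf ideal. The
   kernel of H -> A is one as well, since it contains S^+ = S /\ ker eps.
   Under the stronger hypothesis, rho R_j = z (x) 1 for some z because S maps
   to the scalars of A, and applying id (x) eps gives z = R_j. *)

Require Import Defs.
From HB Require Import structures.
From mathcomp Require Import all_boot all_algebra.
From mathcomp Require Import finmap boolp classical_sets.
From mathcomp Require Import monalg.

Set Implicit Arguments.
Unset Strict Implicit.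
Unset Printing Implicit Defensive.

Import GRing.Theory.

Local Open Scope classical_set_scope.
Local Open Scope ring_scope.

Section LinearMaps.
Variables (K : fieldType) (U V : lmodType K) (f : U -> V).
Hypothesis fl : linear f.

Let g : {linear U -> V} :=
  HB.pack_for {linear U -> V} f (GRing.isLinear.Build K U V *:%R f fl).

Lemma lin0 : f 0 = 0. Proof. exact: (linear0 g). Qed.
Lemma linB x y : f (x - y) = f x - f y. Proof. exact: (linearB g). Qed.
Lemma linZ a x : f (a *: x) = a *: f x. Proof. exact: (linearZ_LR g). Qed.
Lemma lin_sum (T : Type) (r : seq T) F :
  f (\sum_(i <- r) F i) = \sum_(i <- r) f (F i).
Proof. exact: (linear_sum g). Qed.

End LinearMaps.

Section TensorMaps.
Variable K : fieldType.
Implicit Types U V W X Y : lmodType K.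

Lemma bilin_comp V W V' W' U (f : V' -> W' -> U) (u : V -> V') (v : W -> W') :
  bilin f -> linear u -> linear v -> bilin (fun a b => f (u a) (v b)).
Proof.
move=> [fl fr] ul vl; split=> [a k x y|b k x y] /=; first by rewrite vl fl.
by rewrite ul fr.
Qed.

Lemma lin_comp U V W (f : V -> W) (g : U -> V) :
  linear f -> linear g -> linear (fun x => f (g x)).
Proof. by move=> fl gl k x y; rewrite gl fl. Qed.

Lemma tliftE V W U (f : V -> W -> U) t :
  tlift f t = \sum_(k <- msupp (lrepr t : {malg K[(V * W)%type]}))
                (lrepr t : {malg K[(V * W)%type]})@_k *: f k.1 k.2.
Proof. by rewrite tlift.unlock flift.unlock. Qed.

Lemma eq_tlift V W U (f g : V -> W -> U) t :
  (forall a b, f a b = g a b) -> tlift f t = tlift g t.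
Proof. by move=> fg; rewrite !tliftE; apply: eq_bigr => k _; rewrite fg. Qed.

Lemma lin_tlift V W U X (h : U -> X) (f : V -> W -> U) t :
  linear h -> h (tlift f t) = tlift (fun a b => h (f a b)) t.
Proof.
by move=> hl; rewrite !tliftE lin_sum //; apply: eq_bigr => k _; rewrite linZ.
Qed.

Lemma tlift_exchange V W X Y U (f : V -> W -> X -> Y -> U) s t :
  tlift (fun a b => tlift (f a b) t) s =
  tlift (fun c d => tlift (fun a b => f a b c d) s) t.
Proof.
rewrite !tliftE; under eq_bigr do rewrite tliftE scaler_sumr.
rewrite exchange_big /=; apply: eq_bigr => k _.
rewrite tliftE scaler_sumr; apply: eq_bigr => l _.
by rewrite !scalerA mulrC.
Qed.

Lemma tmap_linear V W V' W' (u : V -> V') (v : W -> W') :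
  linear u -> linear v -> linear (tmap u v).
Proof.
move=> ul vl; apply: tlift_linear.
by apply: bilin_comp => //; exact: tpure_bilin.
Qed.

Lemma tmap_pure V W V' W' (u : V -> V') (v : W -> W') a b :
  linear u -> linear v -> tmap u v (a *t b) = u a *t v b.
Proof.
move=> ul vl; rewrite /tmap tlift_pure //.
by apply: bilin_comp => //; exact: tpure_bilin.
Qed.

Lemma tlift_tmap V W V' W' U (f : V' -> W' -> U) (u : V -> V') (v : W -> W') t :
  bilin f -> tlift f (tmap u v t) = tlift (fun a b => f (u a) (v b)) t.
Proof.
move=> bf; rewrite /tmap lin_tlift; last exact: tlift_linear.
by apply: eq_tlift => a b; rewrite tlift_pure.
Qed.

Lemma tmap_tmap V W V' W' V'' W'' (u : V -> V') (v : W -> W') (u' : V' -> V'')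
    (v' : W' -> W'') t :
    linear u' -> linear v' ->
  tmap u' v' (tmap u v t) = tmap (u' \o u) (v' \o v) t.
Proof.
move=> ul vl; rewrite {1}/tmap tlift_tmap //.
by apply: bilin_comp => //; exact: tpure_bilin.
Qed.

Lemma tassoc_bilin U V W : bilin (fun (t : tensor U V) (w : W) =>
  tlift (fun u v => u *t (v *t w)) t).
Proof.
split=> [t|w].
  apply: tlift_param => u v k x y /=.
  by rewrite (tpure_bilin _ _).1 (tpure_bilin _ _).1.
apply: tlift_linear; split=> [u k x y|v k x y] /=.
  by rewrite (tpure_bilin _ _).2 (tpure_bilin _ _).1.
by rewrite (tpure_bilin _ _).2.
Qed.

Definition trilin U V W X (g : U -> V -> W -> X) :=
  [/\ forall v w, linear (fun u => g u v w),
      forall u w, linear (fun v => g u v w) &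
      forall u v, linear (g u v)].

Lemma tlift3_bilin U V W X (g : U -> V -> W -> X) : trilin g ->
  bilin (fun u (t : tensor V W) => tlift (g u) t).
Proof.
move=> [g1 g2 g3]; split=> [u|t]; last by apply: tlift_param.
by apply: tlift_linear; split=> [v|w].
Qed.

Lemma tlift3_tassoc U V W X (g : U -> V -> W -> X) t : trilin g ->
  tlift (fun u s => tlift (g u) s) (tassoc t) =
  tlift (fun s w => tlift (fun u v => g u v w) s) t.
Proof.
move=> tg; have bg := tlift3_bilin tg; have [g1 g2 g3] := tg.
rewrite /tassoc lin_tlift; last exact: tlift_linear.
apply: eq_tlift => s w; rewrite lin_tlift; last exact: tlift_linear.
apply: eq_tlift => u v; rewrite tlift_pure // tlift_pure //.
Qed.

Lemma tmap_tassoc U V W U' V' W' (u : U -> U') (v : V -> V') (w : W -> W') t :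
    linear u -> linear v -> linear w ->
  tmap u (tmap v w) (tassoc t) = tassoc (tmap (tmap u v) w t).
Proof.
move=> ul vl wl.
have uvwl := tmap_linear ul (tmap_linear vl wl).
rewrite [RHS]tlift_tmap; last exact: tassoc_bilin.
rewrite [in LHS]/tassoc (lin_tlift _ _ uvwl); apply: eq_tlift => s c.
rewrite (lin_tlift _ _ uvwl) tlift_tmap; last first.
  split=> [x k y z|x k y z]; last by rewrite (tpure_bilin _ _).2.
  by rewrite (tpure_bilin _ _).2 (tpure_bilin _ _).1.
by apply: eq_tlift => a b; rewrite !tmap_pure //; exact: tmap_linear.
Qed.

End TensorMaps.

Section TensorProductMul.
Variable K : fieldType.

Lemma tpureM (A B : pzAlgType K) (a c : A) (b d : B) :
  (a *t b) * (c *t d) = (a * c) *t (b * d).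
Proof. exact: tmul_pure. Qed.

Lemma tlift_mul (A B : pzAlgType K) (U : lmodType K) (f : A -> B -> U)
    (s t : tensor A B) : bilin f ->
  tlift f (s * t) =
  tlift (fun (a : A) (b : B) =>
    tlift (fun (c : A) (d : B) => f (a * c) (b * d)) t) s.
Proof.
move=> bf; rewrite [s * t](_ : _ = tmul s t) // tmul.unlock.
rewrite lin_tlift; last exact: tlift_linear.
apply: eq_tlift => a b; rewrite lin_tlift; last exact: tlift_linear.
by apply: eq_tlift => c d; rewrite tlift_pure.
Qed.

Lemma mulr_linear (A : pzAlgType K) (a : A) : linear (fun x : A => x * a).
Proof. by move=> k x y; rewrite mulrDl pzscalerAl. Qed.

Lemma mull_linear (A : pzAlgType K) (a : A) : linear (fun x : A => a * x).
Proof. by move=> k x y; rewrite mulrDr pzscalerAr. Qed.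

Lemma mul_bilin (A : pzAlgType K) : bilin (fun x y : A => x * y).
Proof. by split=> x; [exact: mull_linear | exact: mulr_linear]. Qed.

Lemma tmap_alg_hom (A B A' B' : pzAlgType K) (f : A -> A') (g : B -> B') :
  is_alg_hom f -> is_alg_hom g -> is_alg_hom (tmap f g).
Proof.
move=> [fl [f1 fM]] [gl [g1 gM]]; have fgl := tmap_linear fl gl.
split=> //; split=> [|s t].
  rewrite [X in tmap _ _ X](_ : 1 = (1 : A) *t (1 : B)) //.
  by rewrite tmap_pure // f1 g1.
elim/tensor_ind: s => [|k s s' hs hs'|a b].
- by rewrite mul0r (lin0 fgl) mul0r.
- by rewrite mulrDl pzscalerAl !fgl hs hs' mulrDl pzscalerAl.
elim/tensor_ind: t => [|k s s' hs hs'|c d].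
- by rewrite mulr0 (lin0 fgl) mulr0.
- by rewrite mulrDr pzscalerAr !fgl hs hs' mulrDr pzscalerAr.
by rewrite tpureM !tmap_pure // tpureM fM gM.
Qed.

End TensorProductMul.

Section Antipode.
Variables (K : fieldType) (H : pzAlgType K) (h : hopf_structure H).
Local Notation Delta := (comul h).
Local Notation eps := (counit h).
Local Notation S := (antipode h).

Let Dl : linear Delta := (comul_hom h).1.
Let DM x y : Delta (x * y) = Delta x * Delta y := (comul_hom h).2.2 x y.
Let epsM x y : eps (x * y) = eps x * eps y := (counit_hom h).2.2 x y.
Let Sl : linear S := antipode_linear h.

Lemma counit_linear : linear (eps : H -> K^o).
Proof. exact: (counit_hom h).1. Qed.

Lemma tlift_coassoc (U : lmodType K) (g : H -> H -> H -> U) x : trilin g ->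
  tlift (fun a c => tlift (fun b b' => g b b' c) (Delta a)) (Delta x) =
  tlift (fun a b => tlift (g a) (Delta b)) (Delta x).
Proof.
move=> tg; have bg := tlift3_bilin tg; have [g1 g2 g3] := tg.
have /(congr1 (tlift (fun u s => tlift (g u) s))) := comulA h x.
rewrite tlift3_tassoc // !tlift_tmap //.
by split=> [s|w]; [apply: tlift_param | apply: tlift_linear; split=> ?].
Qed.

(* The product of Hom(H (x) H, H) for the convolution, written for bilinear
   maps to avoid a coalgebra structure on H (x) H. *)
Let conv (f g : H -> H -> H) x y :=
  tlift (fun a b => tlift (fun c d => f a c * g b d) (Delta y)) (Delta x).

Let convA f g k x y : bilin f -> bilin g -> bilin k ->
  conv (conv f g) k x y = conv f (conv g k) x y.
Proof.
move=> [fl fr] [gl gr] [kl kr].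
transitivity (tlift (fun x1 x2 => tlift (fun a b => tlift (fun y1 y2 =>
    tlift (fun c d => f a c * (g b d * k x2 y2)) (Delta y1)) (Delta y))
    (Delta x1)) (Delta x)).
  apply: eq_tlift => x1 x2; rewrite [RHS]tlift_exchange.
  apply: eq_tlift => y1 y2.
  rewrite (lin_tlift _ _ (@mulr_linear _ _ _)); apply: eq_tlift => a b.
  rewrite (lin_tlift _ _ (@mulr_linear _ _ _)); apply: eq_tlift => c d.
  by rewrite mulrA.
rewrite (tlift_coassoc (g := fun a b x2 => tlift (fun y1 y2 =>
    tlift (fun c d => f a c * (g b d * k x2 y2)) (Delta y1)) (Delta y)));
    last first.
  split=> a b; do 2!apply: tlift_param => ? ?.
  - by move=> ? ? ?; rewrite /= fr mulr_linear.
  - by move=> ? ? ?; rewrite /= gr mulr_linear mull_linear.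
  - by move=> ? ? ?; rewrite /= kr !mull_linear.
apply: eq_tlift => a x2.
transitivity (tlift (fun b b' => tlift (fun c y2 => tlift (fun d d' =>
    f a c * (g b d * k b' d')) (Delta y2)) (Delta y)) (Delta x2)).
  apply: eq_tlift => b b'.
  rewrite (tlift_coassoc (g := fun c d y2 => f a c * (g b d * k b' y2))) //.
  split=> ? ? ? ? ?.
  - by rewrite fl mulr_linear.
  - by rewrite gl mulr_linear mull_linear.
  - by rewrite kl !mull_linear.
rewrite tlift_exchange; apply: eq_tlift => c y2.
rewrite (lin_tlift _ _ (@mull_linear _ _ _)); apply: eq_tlift => b b'.
by rewrite (lin_tlift _ _ (@mull_linear _ _ _)).
Qed.

Let e x y : H := (eps x * eps y) *: (1 : H).

Let conv_l f x y : bilin f -> conv f e x y = f x y.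
Proof.
move=> [fl fr].
transitivity (tlift (fun a b => eps b *: f a y) (Delta x)).
  apply: eq_tlift => a b.
  rewrite -[in RHS](counitr h y) (lin_tlift _ _ (fl a)).
  rewrite (lin_tlift (h := fun z => eps b *: z)); last first.
    by move=> k u v; rewrite scalerDr !scalerA mulrC.
  by apply: eq_tlift => c d; rewrite /e pzscalerAr mulr1 -scalerA (linZ (fl a)).
rewrite -[in RHS](counitr h x) (lin_tlift _ _ (fr y)).
by apply: eq_tlift => a b; rewrite (linZ (fr y)).
Qed.

Let conv_r f x y : bilin f -> conv e f x y = f x y.
Proof.
move=> [fl fr].
transitivity (tlift (fun a b => eps a *: f b y) (Delta x)).
  apply: eq_tlift => a b.
  rewrite -[in RHS](counitl h y) (lin_tlift _ _ (fl b)).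
  rewrite (lin_tlift (h := fun z => eps a *: z)); last first.
    by move=> k u v; rewrite scalerDr !scalerA mulrC.
  by apply: eq_tlift => c d; rewrite /e pzscalerAl mul1r -scalerA (linZ (fl b)).
rewrite -[in RHS](counitl h x) (lin_tlift _ _ (fr y)).
by apply: eq_tlift => a b; rewrite (linZ (fr y)).
Qed.

Let eq_conv f f' g g' x y : (forall a b, f a b = f' a b) ->
  (forall a b, g a b = g' a b) -> conv f g x y = conv f' g' x y.
Proof.
move=> ff' gg'; apply: eq_tlift => a b; apply: eq_tlift => c d.
by rewrite ff' gg'.
Qed.

(* Both sides are convolution inverses of the product of H. *)
Lemma antipodeM x y : S (x * y) = S y * S x.
Proof.
pose mu a b : H := a * b; pose nu a b := S (a * b); pose sigma a b := S b * S a.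
have bmu : bilin mu by exact: mul_bilin.
have bnu : bilin nu.
  split=> a k u v; rewrite /nu; last by rewrite mulr_linear; exact: Sl.
  by rewrite mull_linear; exact: Sl.
have bsigma : bilin sigma.
  split=> a k u v; rewrite /sigma Sl; first by rewrite mulr_linear.
  by rewrite mull_linear.
have Nl a b : conv nu mu a b = e a b.
  rewrite /conv /nu /mu /e -epsM -(antipodel h) DM.
  rewrite [RHS]tlift_mul //.
  by apply: (bilin_comp (mul_bilin _)) => //.
have Nr a b : conv mu sigma a b = e a b.
  rewrite /e mulrC -scalerA -(antipoder h a).
  rewrite (lin_tlift (h := fun z => eps b *: z)); last first.
    by move=> k u v; rewrite scalerDr !scalerA mulrC.
  apply: eq_tlift => a1 a2; rewrite -pzscalerAl -[in RHS](mulr1 a1) -pzscalerAr.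
  rewrite -(antipoder h b) (lin_tlift _ _ (@mull_linear _ _ _)).
  rewrite (lin_tlift _ _ (@mulr_linear _ _ _)).
  by apply: eq_tlift => b1 b2; rewrite /mu /sigma !mulrA.
rewrite -/(nu x y) -/(sigma y x) -(conv_l x y bnu).
rewrite -(eq_conv x y (f := nu) (g := conv mu sigma)) // -convA //.
by rewrite (eq_conv x y (f' := e) (g' := sigma)) // conv_r.
Qed.

Lemma counit_antipode x : eps (S x) = eps x.
Proof.
have el := counit_linear.
rewrite -[in LHS](counitr h x) (lin_tlift _ _ Sl).
rewrite (lin_tlift (U := H) (X := K^o) (h := eps)) //.
have /(congr1 (eps : H -> K^o)) := antipodel h x.
rewrite (lin_tlift (U := H) (X := K^o) (h := eps)) //.
rewrite (linZ el) (counit_hom h).2.1 [_ *: 1]mulr1 => <-.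
apply: (@eq_tlift K H H K^o) => a b; rewrite (linZ Sl) (linZ el) epsM.
exact: mulrC.
Qed.

End Antipode.

Section Submodules.
Variable K : fieldType.
Implicit Types V W : lmodType K.

Lemma lspan_min V (E P : set V) : is_submod P -> E `<=` P -> lspan E `<=` P.
Proof. by move=> Ps EP x; apply. Qed.

Lemma submodD V (P : set V) x y : is_submod P -> P x -> P y -> P (x + y).
Proof. by move=> [_ Pl] Px Py; rewrite -[x]scale1r; exact: Pl. Qed.

Lemma submodZ V (P : set V) a x : is_submod P -> P x -> P (a *: x).
Proof. by move=> [P0 Pl] Px; rewrite -[_ *: _]addr0; exact: Pl. Qed.

Lemma submodB V (P : set V) x y : is_submod P -> P x -> P y -> P (x - y).
Proof.
by move=> Ps Px Py; rewrite -scaleN1r; apply: submodD => //; exact: submodZ.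
Qed.

Lemma submod_preim V W (f : V -> W) (P : set W) :
  linear f -> is_submod P -> is_submod (f @^-1` P).
Proof.
move=> fl [P0 Pl]; split=> [|a u v Pu Pv]; first by rewrite /preimage/= lin0.
by rewrite /preimage/= fl; exact: Pl.
Qed.

Lemma submod_ker V W (f : V -> W) : linear f -> is_submod (ker f).
Proof.
move=> fl; split=> [|a u v]; rewrite /ker/=; first exact: lin0.
by rewrite fl => -> ->; rewrite scaler0 addr0.
Qed.

Lemma sumsub_submod V (P Q : set V) :
  is_submod P -> is_submod Q -> is_submod (sumsub P Q).
Proof.
move=> [P0 Pl] [Q0 Ql]; split.
  by exists 0 => //; exists 0; rewrite ?addr0.
move=> a _ _ [x Px [y Qy <-]] [x' Px' [y' Qy' <-]].
exists (a *: x + x'); first exact: Pl.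
by exists (a *: y + y'); [exact: Ql | rewrite scalerDr addrACA].
Qed.

Lemma sumsub_min V (P Q T : set V) :
  is_submod T -> P `<=` T -> Q `<=` T -> sumsub P Q `<=` T.
Proof.
move=> Ts PT QT _ [x Px [y Qy <-]].
by apply: submodD => //; [exact: PT | exact: QT].
Qed.

Lemma sub_sumsubl V (P Q : set V) : is_submod Q -> P `<=` sumsub P Q.
Proof. by move=> [Q0 _] x Px; exists x => //; exists 0; rewrite ?addr0. Qed.

Lemma sub_sumsubr V (P Q : set V) : is_submod P -> Q `<=` sumsub P Q.
Proof. by move=> [P0 _] x Qx; exists 0 => //; exists x; rewrite ?add0r. Qed.

Lemma tsub_pure V W (P : set V) (Q : set W) v w :
  P v -> Q w -> tsub P Q (v *t w).
Proof. by move=> Pv Qw; apply: sub_lspan; exists v => //; exists w. Qed.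

Lemma tsub_min V W (P : set V) (Q : set W) (T : set (tensor V W)) :
    is_submod T -> (forall v w, P v -> Q w -> T (v *t w)) ->
  tsub P Q `<=` T.
Proof.
by move=> Ts PQ; apply: lspan_min => // _ [v Pv [w Qw <-]]; exact: PQ.
Qed.

End Submodules.

Section Ideals.
Variable K : fieldType.
Implicit Types A B : pzAlgType K.

Lemma ideal_gen_min A (E P : set A) :
  is_ideal P -> E `<=` P -> ideal_gen E `<=` P.
Proof. by move=> Pi EP x; apply. Qed.

Lemma sub_ideal_gen A (E : set A) : E `<=` ideal_gen E.
Proof. by move=> x Ex P [_]; apply. Qed.

Lemma subalg_gen_min A (E P : set A) :
  is_subalg P -> E `<=` P -> subalg_gen E `<=` P.
Proof. by move=> Ps EP x; apply. Qed.

Lemma subalg_gen_subalg A (E : set A) : is_subalg (subalg_gen E).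
Proof.
split; first split.
- by move=> P [[[]]].
- move=> a u v Eu Ev P PE; have [[Ps _ _] _] := PE.
  by apply: Ps.2; [exact: Eu | exact: Ev].
- by move=> P [[]].
- move=> x y Ex Ey P PE; have [[_ _ PM] _] := PE.
  by apply: PM; [exact: Ex | exact: Ey].
Qed.

Lemma ideal_preim A B (f : A -> B) (P : set B) :
  is_alg_hom f -> is_ideal P -> is_ideal (f @^-1` P).
Proof.
move=> [fl [_ fM]] [Ps Pi]; split; first exact: submod_preim.
by move=> x y /Pi Px; rewrite /preimage/= !fM; have [] := Px (f y).
Qed.

Lemma ideal_ker A B (f : A -> B) : is_alg_hom f -> is_ideal (ker f).
Proof.
move=> [fl [_ fM]]; split; first exact: submod_ker.
by move=> x y; rewrite /ker/= !fM => ->; rewrite mulr0 mul0r.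
Qed.

Lemma sumsub_ideal A (P Q : set A) :
  is_ideal P -> is_ideal Q -> is_ideal (sumsub P Q).
Proof.
move=> [Ps Pi] [Qs Qi]; split; first exact: sumsub_submod.
move=> _ z [x Px [y Qy <-]]; rewrite mulrDr mulrDl.
have [Pl Pr] := Pi _ z Px; have [Ql Qr] := Qi _ z Qy.
split; first by exists (z * x) => //; exists (z * y).
by exists (x * z) => //; exists (y * z).
Qed.

Lemma tsub_ideal A B (P : set A) (Q : set B) :
  is_ideal P -> is_ideal Q -> is_ideal (tsub P Q).
Proof.
move=> [Ps Pi] [Qs Qi]; have Ts : is_submod (tsub P Q) by exact: lspan_submod.
split=> // x y Tx; split; move: x Tx; apply: tsub_min.
- exact: submod_preim (@mull_linear _ _ y) Ts.
- move=> a b Pa Qb; elim/tensor_ind: y => [|k s t hs ht|c d].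
  + by rewrite mul0r; exact: Ts.1.
  + by rewrite mulrDl pzscalerAl; exact: Ts.2.
  + rewrite tpureM; apply: tsub_pure; first exact: (Pi _ _ Pa).1.
    exact: (Qi _ _ Qb).1.
- exact: submod_preim (@mulr_linear _ _ y) Ts.
- move=> a b Pa Qb; elim/tensor_ind: y => [|k s t hs ht|c d].
  + by rewrite mulr0; exact: Ts.1.
  + by rewrite mulrDr pzscalerAr; exact: Ts.2.
  + rewrite tpureM; apply: tsub_pure; first exact: (Pi _ _ Pa).2.
    exact: (Qi _ _ Qb).2.
Qed.

End Ideals.

Section QuotientHopf.
Variables (K : fieldType) (H B : pzAlgType K) (h : hopf_structure H).
Variables (f : H -> B) (g : B -> H).
Hypotheses (fH : is_alg_hom f) (fI : is_hopf_ideal h (ker f)) (gK : cancel g f).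
Local Notation Delta := (comul h).
Local Notation eps := (counit h).
Local Notation S := (antipode h).

Let fl : linear f := fH.1.

Let factor (V : lmodType K) (u : H -> V) x :
  linear u -> (forall y, f y = 0 -> u y = 0) -> u (g (f x)) = u x.
Proof.
move=> ul uf; apply/eqP; rewrite -subr_eq0 -linB //; apply/eqP/uf.
by rewrite linB // gK subrr.
Qed.

Let D y := tmap f f (Delta (g y)).
Let e y := eps (g y).
Let s y := f (S (g y)).

Let Df x : D (f x) = tmap f f (Delta x).
Proof.
have ffl := tmap_linear fl fl.
apply: (factor (u := fun x => tmap f f (Delta x))).
  by apply: lin_comp => //; exact: (comul_hom h).1.
have [_ fD _ _] := fI; move=> y /fD.
apply: (sumsub_min (T := ker (tmap f f))); first exact: submod_ker.
  apply: tsub_min; first exact: submod_ker.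
  move=> v w; rewrite /ker/= tmap_pure // => -> _.
  exact: (lin0 ((tpure_bilin _ _).2 _)).
apply: tsub_min; first exact: submod_ker.
move=> v w; rewrite /ker/= tmap_pure // => _ ->.
exact: (lin0 ((tpure_bilin _ _).1 _)).
Qed.

Let ef x : e (f x) = eps x.
Proof.
have [_ _ fe _] := fI.
by apply: (factor (V := K^o) (u := eps)) => //; exact: counit_linear.
Qed.

Let sf x : s (f x) = f (S x).
Proof.
have [_ _ _ fS] := fI.
apply: (factor (u := fun x => f (S x))) => //.
by apply: lin_comp => //; exact: antipode_linear.
Qed.

Let surj (P : B -> Prop) : (forall x, P (f x)) -> forall y, P y.
Proof. by move=> Pf y; rewrite -[y]gK. Qed.

Let D_hom : is_alg_hom D.
Proof.
have [ffl [ff1 ffM]] := tmap_alg_hom fH fH.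
have [Dl [D1 DM]] := comul_hom h; have [_ [f1 fM]] := fH.
split.
  by move=> a; elim/surj => x; elim/surj => y; rewrite -fl !Df Dl ffl.
split; first by rewrite -f1 Df D1 ff1.
by elim/surj => x; elim/surj => y; rewrite -fM !Df DM ffM.
Qed.

Let e_hom : scalar e /\ monoid_morphism e.
Proof.
have [el [e1 eM]] := counit_hom h; have [_ [f1 fM]] := fH.
split; first by move=> a; elim/surj => x; elim/surj => y; rewrite -fl !ef el.
split; first by rewrite -f1 ef e1.
by elim/surj => x; elim/surj => y; rewrite -fM !ef eM.
Qed.

Let s_linear : linear s.
Proof.
move=> a; elim/surj => x; elim/surj => y; rewrite -fl !sf.
by rewrite (antipode_linear h) fl.
Qed.

Let D_coassoc y : tassoc (tmap D id (D y)) = tmap id D (D y).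
Proof.
elim/surj: y => x; have Dl := D_hom.1; have ffl := tmap_linear fl fl.
rewrite Df !tmap_tmap //.
have -> : D \o f = tmap f f \o Delta by apply/funext => z; exact: Df.
rewrite -[id \o f]/(f \o id) -(tmap_tmap Delta id _ ffl fl).
rewrite -tmap_tassoc // (comulA h).
by rewrite tmap_tmap.
Qed.

Let e_bilin_l : bilin (fun a b : B => e a *: b).
Proof.
split=> a k u v; first by rewrite scalerDr !scalerA mulrC.
by rewrite e_hom.1 scalerDl scalerA.
Qed.

Let e_bilin_r : bilin (fun a b : B => e b *: a).
Proof.
split=> a k u v; last by rewrite scalerDr !scalerA mulrC.
by rewrite e_hom.1 scalerDl scalerA.
Qed.

Let e_counitl y : tlift (fun a b : B => e a *: b) (D y) = y.
Proof.
elim/surj: y => x; rewrite Df tlift_tmap //.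
rewrite -[in RHS](counitl h x) (lin_tlift _ _ fl).
by apply: eq_tlift => a b; rewrite ef linZ.
Qed.

Let e_counitr y : tlift (fun a b : B => e b *: a) (D y) = y.
Proof.
elim/surj: y => x; rewrite Df tlift_tmap //.
rewrite -[in RHS](counitr h x) (lin_tlift _ _ fl).
by apply: eq_tlift => a b; rewrite ef linZ.
Qed.

Let s_antipodel y : tlift (fun a b : B => s a * b) (D y) = e y *: (1 : B).
Proof.
have [_ [f1 fM]] := fH.
elim/surj: y => x; rewrite Df tlift_tmap; last first.
  exact: (bilin_comp (mul_bilin _)).
rewrite ef -f1 -(linZ fl) -antipodel (lin_tlift _ _ fl).
by apply: eq_tlift => a b; rewrite sf fM.
Qed.

Let s_antipoder y : tlift (fun a b : B => a * s b) (D y) = e y *: (1 : B).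
Proof.
have [_ [f1 fM]] := fH.
elim/surj: y => x; rewrite Df tlift_tmap; last first.
  exact: (bilin_comp (mul_bilin _)).
rewrite ef -f1 -(linZ fl) -antipoder (lin_tlift _ _ fl).
by apply: eq_tlift => a b; rewrite sf fM.
Qed.

Lemma hopf_quotient : exists hB : hopf_structure B, is_hopf_hom h hB f.
Proof.
exists (HopfStructure D_hom e_hom s_linear D_coassoc e_counitl e_counitr
  s_antipodel s_antipoder).
by split.
Qed.

End QuotientHopf.

Lemma hopf_hom_factor (K : fieldType) (H A B : pzAlgType K)
    (hH : hopf_structure H) (hA : hopf_structure A) (hB : hopf_structure B)
    (f : H -> A) (g : A -> H) (q : H -> B) (p : A -> B) :
    cancel g f -> (forall x, p (f x) = q x) -> is_alg_hom p ->
    is_hopf_hom hH hA f -> is_hopf_hom hH hB q ->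
  is_hopf_hom hA hB p.
Proof.
move=> gK pf pH [[fl _] fD fe fS] [_ qD qe qS]; have pl := pH.1.
split=> // y; rewrite -[y]gK pf.
- rewrite qD fD tmap_tmap //; congr tmap; apply/funext => z; exact/esym/pf.
- by rewrite qe fe.
- by rewrite qS fS pf.
Qed.

Section Presentations.
Variables (K : fieldType) (I : choiceType).
Implicit Types E F : set (free_alg K I).

Lemma free_alg_ind (P : set (free_alg K I)) :
  is_subalg P -> (forall i, P (gen K i)) -> forall x, P x.
Proof.
move=> [Ps P1 PM] Pg x.
have Pm (k : {fmonom I}) : P (<< k >> : {malg K[{fmonom I}]}).
  case: k => s; elim: s => [|i s IH].
    by rewrite -fmoneE; exact: P1.
  have -> : << FMonom (i :: s) >> = << fmu i >> * << FMonom s >>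
      :> {malg K[{fmonom I}]}.
    rewrite malgM_def fgmulUU mulr1; congr << _ >>.
    by rewrite fmuE; apply/esym/fmmulE.
  exact: PM (Pg i) IH.
rewrite [x](monalgE (x : {malg K[{fmonom I}]})).
elim: (msupp _ : seq _) => [|k s IH]; first by rewrite big_nil; exact: Ps.1.
rewrite big_cons; apply: submodD => //.
have -> : << (x : {malg K[{fmonom I}]})@_k *g k >> =
    (x : {malg K[{fmonom I}]})@_k *: << k >> :> {malg K[{fmonom I}]}.
  apply/malgP=> l; rewrite mcoeffZ !mcoeffU.
  by case: eqP => _ /=; rewrite ?mulr1n ?mulr0n ?mulr1 ?mulr0.
exact: submodZ.
Qed.

Lemma natural_map_alg_hom E F : E `<=` ideal_gen F ->
  is_alg_hom (natural_map F : presented E -> presented F).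
Proof.
move=> EF; have [ql [q1 qM]] := qproj_alg_hom F.
have [pl [p1 pM]] := qproj_alg_hom E.
split.
  move=> a x y; rewrite -[x]qreprK -[y]qreprK -pl.
  by rewrite !natural_map_proj // ql.
split; first by rewrite -p1 natural_map_proj // q1.
by move=> x y; rewrite -[x]qreprK -[y]qreprK -pM !natural_map_proj // qM.
Qed.

Lemma natural_mapK E F : E `<=` ideal_gen F ->
  cancel (natural_map E : presented F -> presented E) (natural_map F).
Proof. by move=> EF y; rewrite natural_map_proj // qreprK. Qed.

Lemma natural_map_comp E F G (x : presented E) :
    E `<=` ideal_gen F -> F `<=` ideal_gen G ->
  natural_map G (natural_map F x) = natural_map G x.
Proof.
move=> EF FG; have EG : E `<=` ideal_gen G.
  by move=> r /EF; apply: ideal_gen_min => //; exact: ideal_gen_ideal.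
by rewrite -[x]qreprK !natural_map_proj.
Qed.

Lemma ker_natural_map_min E F (P : set (presented E)) :
    E `<=` ideal_gen F -> is_ideal P -> (forall r, F r -> P (qproj E r)) ->
  ker (natural_map F) `<=` P.
Proof.
move=> EF Pi PF x; rewrite /ker/= -[x]qreprK natural_map_proj //.
have q0 : qproj F 0 = 0 by exact: (lin0 (qproj_linear F)).
rewrite -q0 => /qprojP; rewrite subr0.
apply: (ideal_gen_min (P := qproj E @^-1` P)) => //.
by apply: ideal_preim => //; exact: qproj_alg_hom.
Qed.

Lemma natural_map_hopf_ideal E F (h : hopf_structure (presented E)) :
    E `<=` ideal_gen F ->
    let I := ker (natural_map F : presented E -> presented F) in
    (forall r, F r ->
      [/\ sumsub (tsub I setT) (tsub setT I) (comul h (qproj E r)),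
          counit h (qproj E r) = 0 &
          I (antipode h (qproj E r))]) ->
  is_hopf_ideal h I.
Proof.
move=> EF J FJ.
have Ji : is_ideal J by exact: (ideal_ker (natural_map_alg_hom EF)).
split=> //.
- pose T : set (tensor (presented E) (presented E)) :=
    sumsub (tsub J setT) (tsub setT J).
  apply: (@ker_natural_map_min E F (comul h @^-1` T) EF); last first.
    by move=> r /FJ[].
  apply: ideal_preim; first exact: comul_hom.
  by apply: sumsub_ideal; apply: tsub_ideal.
- apply: (@ker_natural_map_min E F (ker (counit h)) EF); last by move=> r /FJ[].
  split; first exact: (submod_ker (counit_linear h)).
  move=> u v; rewrite /ker/= !(counit_hom h).2.2 => ->.
  by rewrite mulr0 mul0r.
- apply: (@ker_natural_map_min E F (antipode h @^-1` J) EF); last first.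
    by move=> r /FJ[].
  split; first exact: (submod_preim (antipode_linear h) Ji.1).
  move=> u v /Ji.2 Ju; rewrite /preimage/= !antipodeM.
  by have [] := Ju (antipode h v).
Qed.

End Presentations.

Lemma centralizer_subalg (K : fieldType) (A : pzAlgType K) (z : A) :
  is_subalg [set x | z * x = x * z].
Proof.
split; first split=> [|a u v]; rewrite /= ?mulr0 ?mul0r //.
- by rewrite mull_linear mulr_linear => -> ->.
- by rewrite mulr1 mul1r.
- by move=> x y zx zy; rewrite /= mulrA zx -mulrA zy mulrA.
Qed.

Lemma subalg_preim (K : fieldType) (A B : pzAlgType K) (f : A -> B)
    (P : set B) :
  is_alg_hom f -> is_subalg P -> is_subalg (f @^-1` P).
Proof.
move=> [fl [f1 fM]] [Ps P1 PM]; split; first exact: submod_preim.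
  by rewrite /preimage/= f1.
by move=> x y Px Py; rewrite /preimage/= fM; exact: PM.
Qed.

Lemma centre_subalg (K : fieldType) (A : pzAlgType K) : is_subalg (centre A).
Proof.
split; first split=> [y|a u v uc vc y]; rewrite /= ?mulr0 ?mul0r //.
- by rewrite mull_linear mulr_linear uc vc.
- by move=> y; rewrite mulr1 mul1r.
- by move=> x y xc yc z; rewrite -mulrA yc mulrA xc mulrA.
Qed.

Lemma tcommutator_sub (K : fieldType) (A B : pzAlgType K) (f : A -> B) :
    is_alg_hom f ->
  forall t u, tsub (f @^-1` centre B) (f @^-1` centre B) t ->
  sumsub (tsub (ker f) setT) (tsub setT (ker f)) (u * t - t * u).
Proof.
move=> fh t u; set T := sumsub _ _.
have [fl [_ fM]] := fh; have fi := ideal_ker fh.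
have Ts : is_submod T by apply: sumsub_submod; exact: lspan_submod.
have Tl : tsub (ker f) setT `<=` T by apply: sub_sumsubl; exact: lspan_submod.
have Tr : tsub setT (ker f) `<=` T by apply: sub_sumsubr; exact: lspan_submod.
have comm_lin (s : tensor A A) : linear (fun x => s * x - x * s).
  move=> k x y; rewrite mull_linear mulr_linear scalerBr opprD -!addrA.
  by congr (_ + _); rewrite addrCA.
apply: (tsub_min (T := [set t | T (u * t - t * u)])).
  exact: (submod_preim (comm_lin u) Ts).
move=> c d fc fd /=.
elim/tensor_ind: u => [|k x y hx hy|a b].
- by rewrite mul0r mulr0 subr0; exact: Ts.1.
- rewrite -[_ - _]opprB (comm_lin (c *t d)) -scaleN1r; apply: submodZ => //.
  by apply: Ts.2; rewrite -opprB -scaleN1r; apply: submodZ.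
rewrite !tpureM.
have -> : (a * c) *t (b * d) - (c * a) *t (d * b) =
    (a * c - c * a) *t (b * d) + (c * a) *t (b * d - d * b).
  have [tr tl] := tpure_bilin A A.
  by rewrite (linB (tl _)) (linB (tr _)) addrA subrK.
apply: submodD => //.
  apply: Tl; apply: tsub_pure => //; rewrite /ker/= (linB fl) !fM.
  by rewrite fc subrr.
apply: Tr; apply: tsub_pure => //; rewrite /ker/= (linB fl) !fM.
by rewrite fd subrr.
Qed.

Lemma tsubS (K : fieldType) (V W : lmodType K) (P P' : set V) (Q Q' : set W) :
  P `<=` P' -> Q `<=` Q' -> tsub P Q `<=` tsub P' Q'.
Proof.
move=> PP QQ; apply: tsub_min; first exact: lspan_submod.
by move=> v w /PP Pv /QQ Qw; exact: tsub_pure.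
Qed.

Lemma coinvariants_subalg (K : fieldType) (A B : pzAlgType K)
  (rho : A -> tensor A B) : is_alg_hom rho -> is_subalg (coinvariants rho).
Proof.
move=> [rl [r1 rM]]; have [_ tl] := tpure_bilin A B.
split; first split=> [|a u v]; rewrite /coinvariants/=.
- by rewrite (lin0 rl) (lin0 (tl _)).
- by rewrite rl tl => -> ->.
- by rewrite r1.
- by move=> x y xc yc; rewrite rM xc yc tpureM mulr1.
Qed.

(* Applying [id (x) eps] to [rho y] recovers [y], so [rho y = z (x) 1] forces
   [z = y]. *)
Lemma coinvariants_coaction (K : fieldType) (A B : pzAlgType K)
    (hA : hopf_structure A) (hB : hopf_structure B) (f : A -> B) y z :
    is_hopf_hom hA hB f -> coaction hA f y = z *t (1 : B) ->
  coinvariants (coaction hA f) y.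
Proof.
move=> [[fl _] _ fe _] yz; rewrite /coinvariants/= yz; congr (_ *t _).
have be : bilin (fun (a : A) (b : B) => counit hB b *: a).
  split=> a k u v; last by rewrite scalerDr !scalerA mulrC.
  by rewrite (counit_hom hB).1 scalerDl scalerA.
rewrite -[RHS](counitr hA).
have := congr1 (tlift (fun (a : A) (b : B) => counit hB b *: a)) yz.
rewrite tlift_pure // (counit_hom hB).2.1 scale1r tlift_tmap // => <-.
by apply: eq_tlift => a b; rewrite fe.
Qed.

Lemma coaction_alg_hom (K : fieldType) (A B : pzAlgType K)
    (hA : hopf_structure A) (f : A -> B) :
  is_alg_hom f -> is_alg_hom (coaction hA f).
Proof.
move=> fh; have idh : is_alg_hom (@id A) by [].
have [ml [m1 mM]] := tmap_alg_hom idh fh; have [dl [d1 dM]] := comul_hom hA.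
split; first exact: lin_comp.
by split=> [|x y]; rewrite /coaction ?d1 // dM mM.
Qed.

Theorem theorem2p5 (K : fieldType) (I : choiceType) (J : Type) (J0 : set J)
    (R : J -> free_alg K I)
    (hH : hopf_structure (presented (R @` (~` J0)))) :
  let relH := R @` (~` J0) in
  let relc := centrification_rels J0 R in
  let relA := range R in
  let H := presented relH in
  let Ac := presented relc in
  let A := presented relA in
  let pi : H -> Ac := @natural_map K I relH relc in
  let p : Ac -> A := @natural_map K I relc relA in
  let q : H -> A := @natural_map K I relH relA in
  let Rt (j : J) : H := qproj relH (R j) in
  let Rc (j : J) : Ac := qproj relc (R j) in
  let S : set H := subalg_gen (Rt @` J0) in
  let Sp : set H := S `&` ker (counit hH) in
  let C : set H := pi @^-1` centre Ac in
  let Z : set Ac := subalg_gen (Rc @` J0) in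
  (forall j, J0 j ->
     sumsub (tsub Sp C) (tsub C Sp) (comul hH (Rt j))) ->
  (forall j, J0 j -> S (antipode hH (Rt j))) ->
  (forall j, J0 j -> counit hH (Rt j) = 0) ->
  [/\ is_hopf_ideal hH (ker pi),
      is_hopf_ideal hH (ker q) &
      exists (hc : hopf_structure Ac) (hA : hopf_structure A),
        [/\ is_hopf_hom hH hc pi,
            is_hopf_hom hH hA q,
            is_hopf_hom hc hA p &
            (forall j, J0 j ->
               sumsub (tsub Sp S) (tsub C Sp) (comul hH (Rt j))) ->
            is_subalg Z /\ Z `<=` coinvariants (coaction hc p)]].
Proof.
move=> relH relc relA H Ac A pi p q Rt Rc S Sp C Z DR SR eR.
have Hc : relH `<=` ideal_gen relc by move=> r Hr; apply: sub_ideal_gen; right.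
have HA : relH `<=` ideal_gen relA.
  by move=> _ [j _ <-]; apply: sub_ideal_gen; exists j.
have cA : relc `<=` ideal_gen relA.
  move=> r [[i _ [j _ <-]]|Hr]; last exact: HA.
  have [Is Ii] := ideal_gen_ideal relA.
  have Aj : ideal_gen relA (R j) by apply: sub_ideal_gen; exists j.
  have [Al Ar] := Ii _ (gen K i) Aj; exact: (submodB Is Al Ar).
have pih : is_alg_hom pi by exact: natural_map_alg_hom.
have qh : is_alg_hom q by exact: natural_map_alg_hom.
have ph : is_alg_hom p by exact: natural_map_alg_hom.
have piRt j : pi (Rt j) = Rc j by exact: natural_map_proj.
have qRt j : q (Rt j) = 0.
  rewrite [LHS]natural_map_proj // -(lin0 (qproj_linear relA)).
  by apply/qprojP; rewrite subr0; apply: sub_ideal_gen; exists j.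
have Rt0 j : ~ J0 j -> Rt j = 0.
  move=> Jj; rewrite /Rt -(lin0 (qproj_linear relH)); apply/qprojP.
  by rewrite subr0; apply: sub_ideal_gen; exists j.
have qHh := qproj_alg_hom relH; have qch := qproj_alg_hom relc.
have SC : S `<=` C.
  apply: subalg_gen_min; first exact: subalg_preim (centre_subalg _).
  move=> _ [j Jj <-]; rewrite /C/preimage/= piRt => y; rewrite -[y]qreprK.
  apply: (free_alg_ind (P := qproj relc @^-1` [set x | Rc j * x = x * Rc j])).
    by apply: subalg_preim => //; exact: centralizer_subalg.
  move=> i /=; rewrite /preimage/= -!qch.2.2; apply/esym/qprojP.
  by apply: sub_ideal_gen; left; exists i => //; exists j.
have Ssub : is_subalg S by exact: subalg_gen_subalg.
have Sq s : S s -> q s = counit hH s *: (1 : A).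
  apply: (subalg_gen_min (P := [set s | q s = counit hH s *: (1 : A)])).
    split; first split.
    - by rewrite /= (lin0 qh.1) (lin0 (counit_linear hH)) scale0r.
    - move=> a u v /= qu qv.
      by rewrite qh.1 (counit_hom hH).1 qu qv scalerDl scalerA.
    - by rewrite /= qh.2.1 (counit_hom hH).2.1 scale1r.
    - move=> u v /= qu qv; rewrite qh.2.2 (counit_hom hH).2.2 qu qv.
      by rewrite pzscalerAl mul1r scalerA.
  by move=> _ [j Jj <-]; rewrite /= qRt eR // scale0r.
have Spq s : Sp s -> q s = 0 by move=> [/Sq -> ->]; rewrite scale0r.
have SpC : Sp `<=` C by move=> s [/SC].
have pi_hopf : is_hopf_ideal hH (ker pi).
  apply: natural_map_hopf_ideal => //.
  have pii := ideal_ker pih; have [piis piim] := pii.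
  have TT : is_ideal (sumsub (tsub (ker pi) setT) (tsub setT (ker pi))).
    by apply: sumsub_ideal; apply: tsub_ideal.
  move=> r [[i _ [j Jj <-]]|Hr]; last first.
    have -> : qproj relH r = 0.
      rewrite -(lin0 (qproj_linear relH)); apply/qprojP.
      by rewrite subr0; exact: sub_ideal_gen.
    rewrite (lin0 (comul_hom hH).1) (lin0 (counit_linear hH)).
    rewrite (lin0 (antipode_linear hH)).
    by split=> //; [exact: TT.1.1 | exact: piis.1].
  pose x : H := qproj relH (gen K i).
  have -> : qproj relH (gen K i * R j - R j * gen K i) = x * Rt j - Rt j * x.
    by rewrite (linB qHh.1); congr (_ - _); exact: qHh.2.2.
  split.
  - rewrite (linB (comul_hom hH).1) !(comul_hom hH).2.2.
    apply: (tcommutator_sub pih).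
    apply: (sumsub_min _ _ _ (DR j Jj)); first exact: lspan_submod.
      exact: tsubS.
    exact: tsubS.
  - by rewrite (linB (counit_linear hH)) !(counit_hom hH).2.2 mulrC subrr.
  - rewrite (linB (antipode_linear hH)) !antipodeM.
    rewrite -[ker pi _]/(pi _ = 0) (linB pih.1) !pih.2.2.
    by rewrite (SC _ (SR j Jj)) subrr.
have q_hopf : is_hopf_ideal hH (ker q).
  apply: natural_map_hopf_ideal => //.
  have qi := ideal_ker qh; have [qis qim] := qi.
  have TT : is_ideal (sumsub (tsub (ker q) setT) (tsub setT (ker q))).
    by apply: sumsub_ideal; apply: tsub_ideal.
  move=> _ [j _ <-]; rewrite -/(Rt j).
  have [Jj|/Rt0 ->] := EM (J0 j); last first.
    rewrite (lin0 (comul_hom hH).1) (lin0 (counit_linear hH)).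
    rewrite (lin0 (antipode_linear hH)).
    by split=> //; [exact: TT.1.1 | exact: qis.1].
  split; last 2 first.
  - exact: eR.
  - rewrite -[ker q _]/(q _ = 0) Sq ?counit_antipode ?eR ?scale0r //.
    exact: SR.
  apply: (sumsub_min _ _ _ (DR j Jj)); first exact: TT.1.
    move=> t Tt; apply: sub_sumsubl; first exact: lspan_submod.
    by apply: tsubS Tt => // s; exact: Spq.
  move=> t Tt; apply: sub_sumsubr; first exact: lspan_submod.
  by apply: tsubS Tt => // s; exact: Spq.
split=> //.
have [hc hcP] := hopf_quotient pih pi_hopf (natural_mapK Hc).
have [hA hAP] := hopf_quotient qh q_hopf (natural_mapK HA).
have pP : is_hopf_hom hc hA p.
  apply: (hopf_hom_factor (natural_mapK Hc) _ ph hcP hAP) => x.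
  exact: natural_map_comp.
exists hc, hA; split=> // DRS; split; first exact: subalg_gen_subalg.
apply: subalg_gen_min; first exact/coinvariants_subalg/coaction_alg_hom.
move=> _ [j Jj <-].
pose W : set (tensor Ac A) := [set t | exists z, t = z *t (1 : A)].
have [tr tl] := tpure_bilin Ac A.
have Ws : is_submod W.
  split; first by exists 0; rewrite (lin0 (tl _)).
  by move=> a _ _ [z ->] [z' ->]; exists (a *: z + z'); rewrite tl.
have piql := tmap_linear pih.1 qh.1.
have DW : (tmap pi q @^-1` W) (comul hH (Rt j)).
  have PW : is_submod (tmap pi q @^-1` W) by exact: submod_preim.
  apply: (sumsub_min _ _ _ (DRS j Jj)) => //; apply: tsub_min => // s s' Ss Ss'.
    rewrite /preimage/= tmap_pure ?Sq //; try exact: pih.1; try exact: qh.1.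
    exists (counit hH s' *: pi s).
    by rewrite (linZ (tr _)) (linZ (tl _)).
  rewrite /preimage/= tmap_pure; [|exact: pih.1|exact: qh.1].
  by rewrite Spq // (lin0 (tr _)); exact: Ws.1.
have [z Dz] := DW.
apply: (coinvariants_coaction pP (z := z)).
rewrite -Dz -piRt /coaction; have [_ -> _ _] := hcP.
rewrite tmap_tmap //; last exact: ph.1.
congr tmap; apply/funext => x; exact: natural_map_comp.
Qed.
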